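(* For all integers $n \geq 2$, $$\sum_{\pi \in \mathcal{F}(n; 312)} q^{\mathtt{inv}(\pi)} = (1+q)^{n-2}.$$
   Context: For a positive integer $n$, $[n]=\{1,\dots,n\}$, and a permutation $\sigma$ of $[n]$ is written as the word $\sigma(1)\sigma(2)\cdots\sigma(n)$. A run of $\sigma$ is a maximal block of consecutive positions on which $\sigma$ is increasing, so $\sigma$ is uniquely the concatenation of its runs; the starting point of a run is its first entry. A flattened partition over $[n]$ is a permutation of $[n]$ whose runs, read from left to right, have increasing starting points. A permutation contains a pattern $\tau$ if it has a (not necessarily contiguous) subsequence order-isomorphic to $\tau$; otherwise it is $\tau$-avoiding. $\mathcal{F}(n;\tau)$ is the set of $\tau$-avoiding flattened partitions over $[n]$. $\mathtt{inv}(\pi) = |\{(i,j) : i<j,\ \pi(i)>\pi(j)\}|$ is the number of inversions of $\pi$. Here $q$ is an indeterminate. *)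

(* Defs.v *)
From mathcomp Require Import all_boot all_fingroup all_algebra.

Set Implicit Arguments.
Unset Strict Implicit.
Unset Printing Implicit Defensive.

(* A permutation of [n] is a permutation s : 'S_n of 'I_n = {0, ..., n-1}:
   positions and values are both shifted down by one, which changes neither
   their order nor the runs, patterns and inversions. *)

Definition increasing_block n (s : 'S_n) (a b : 'I_n) : bool :=
  (a <= b) &&
  [forall i : 'I_n, forall j : 'I_n,
     [&& a <= i, i < j & j <= b] ==> (s i < s j)].

(* The positions a, ..., b form a run; its starting point is s a. *)
Definition is_run n (s : 'S_n) (a b : 'I_n) : bool :=
  increasing_block s a b &&
  [forall c : 'I_n, forall d : 'I_n,
     [&& c <= a, b <= d & increasing_block s c d] ==> (c == a) && (d == b)].

Definition flattened n (s : 'S_n) : bool :=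
  [forall a : 'I_n, forall b : 'I_n, forall c : 'I_n, forall d : 'I_n,
     [&& is_run s a b, is_run s c d & a < c] ==> (s a < s c)].

Definition contains n k (s : 'S_n) (t : 'S_k) : bool :=
  [exists f : {ffun 'I_k -> 'I_n},
     [forall i : 'I_k, forall j : 'I_k, (i < j) ==> (f i < f j)] &&
     [forall i : 'I_k, forall j : 'I_k, (s (f i) < s (f j)) == (t i < t j)]].

Definition avoids n k (s : 'S_n) (t : 'S_k) : bool := ~~ contains s t.

Definition flattened_avoiding n k (t : 'S_k) : {set 'S_n} :=
  [set s : 'S_n | flattened s && avoids s t].

Definition num_inv n (s : 'S_n) : nat :=
  #|[set ij : 'I_n * 'I_n | (ij.1 < ij.2) && (s ij.2 < s ij.1)]|.

Definition fun312 (i : 'I_3) : 'I_3 := inord (nth 0 [:: 2; 0; 1] i).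

Lemma fun312_inj : injective fun312.
Proof.
move=> [[|[|[|i]]] hi] [[|[|[|j]]] hj] //= /(congr1 val);
  rewrite /fun312 /= !inordK // => _; exact: val_inj.
Qed.

Definition p312 : 'S_3 := perm fun312_inj.

Lemma p312_word : [seq (p312 i : nat).+1 | i <- enum 'I_3] = [:: 3; 1; 2].
Proof. by rewrite !enum_ordSl enum_ord0 /= !permE /fun312 /= !inordK. Qed.

(* Main.v *)
Require Import Defs.
From mathcomp Require Import all_boot all_fingroup all_algebra.
From mathcomp Require Import zify.
Import GRing.Theory.
Local Open Scope ring_scope.

(** The 312-avoiding flattened partitions are exactly the permutations that fix
    the first position and satisfy s i <= i + 1 everywhere
    ([flattened_avoiding312E]); the generating function of the latter then
    follows by peeling off first entries.

    The link is the pattern 321. Starting points of runs increase from left to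
    right, so a pattern 321 in a flattened permutation can be traded for a
    pattern 312: replace the 2 by the starting point of its run. This run
    begins strictly after the 3, and its starting point is smaller than that of
    the later run containing the 1, hence smaller than the 1. So a 312-avoiding
    flattened permutation has no entry followed by two smaller ones, and by the
    pigeonhole principle this says s i <= i + 1 for all i ([hessenbergP]).
    Conversely, if no entry is followed by two smaller ones, then 312 is avoided
    and two run starts in the wrong order are impossible, because the entry just
    before the first of them would be larger than both, unless this first one is
    the entry 0 at position 0.

    A permutation with s i <= i + 1 begins with 0 or 1. Deleting the first
    entry and standardizing gives a permutation of the same kind, subject to
    no other condition, and removes s 0 inversions. Each deletion thus
    contributes a factor 1 + q ([sum_inv_hessenberg]), except the first one:
    there s 0 = 0 is imposed and the factor is 1. *)

Set Implicit Arguments.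
Unset Strict Implicit.
Unset Printing Implicit Defensive.

(** * Runs and flattened permutations *)

(** The run starts are the descent bottoms and position 0, at which the
    quantifier is over an empty range. *)
Definition run_start n (s : 'S_n) (a : 'I_n) : Prop :=
  forall b : 'I_n, b.+1 = a :> nat -> (s a < s b)%N.

Lemma perm_val_neq n (s : 'S_n) (i j : 'I_n) : (i < j)%N -> (s i : nat) <> s j.
Proof. by move=> lt_ij /val_inj/perm_inj eij; move: lt_ij; rewrite eij ltnn. Qed.

Lemma increasing_blockP n (s : 'S_n) (a b : 'I_n) :
  reflect ((a <= b)%N /\ forall i j : 'I_n,
             (a <= i)%N -> (i < j)%N -> (j <= b)%N -> (s i < s j)%N)
          (increasing_block s a b).
Proof.
apply: (iffP andP) => -[le_ab inc]; split=> //.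
  move=> i j le_ai lt_ij le_jb; have /forallP/(_ j)/implyP := forallP inc i.
  by apply; apply/and3P.
by apply/forallP=> i; apply/forallP=> j; apply/implyP=> /and3P[]; apply: inc.
Qed.

Lemma run_startP n (s : 'S_n) (a : 'I_n) :
  run_start s a <-> exists b, is_run s a b.
Proof.
split=> [start_a | [b /andP[/increasing_blockP[le_ab inc_ab] max_ab]] c ca].
  have inc_aa : increasing_block s a a by apply/increasing_blockP; split=> //; lia.
  (* Extend the increasing block from a as far to the right as possible. *)
  case: (@arg_maxnP _ a (increasing_block s a) val inc_aa) => b inc_ab max_b.
  exists b; rewrite /is_run inc_ab.
  apply/forallP=> c; apply/forallP=> d; apply/implyP=> /and3P[le_ca le_bd inc_cd].
  have c_a : c = a.
    have [lt_ca|le_ac] := ltnP c a; last by apply: val_inj => /=; lia.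
    have e_lt : (a.-1 < n)%N by have := ltn_ord a; lia.
    have := start_a (Ordinal e_lt) _; rewrite /= prednK ?(leq_ltn_trans _ lt_ca) //.
    move=> /(_ erefl) desc; have /increasing_blockP[_ inc] := inc_cd.
    have le_ab : (a <= b)%N by case/andP: inc_ab.
    have := inc (Ordinal e_lt) a; rewrite /=; lia.
  subst c; rewrite eqxx /=; apply/eqP/val_inj.
  by have := max_b d inc_cd; rewrite /=; lia.
have neq_ca : (s c : nat) <> s a by apply: perm_val_neq; lia.
have [//|lt_sca] := ltnP (s a) (s c).
have /forallP/(_ b)/implyP := forallP max_ab c.
(* Without a descent between c and a, the run [a, b] would extend to c. *)
have -> : increasing_block s c b.
  apply/increasing_blockP; split=> [|i j le_ci lt_ij le_jb]; first lia.
  have [le_ai|lt_ia] := leqP a i; first exact: inc_ab.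
  have -> : i = c by apply: val_inj => /=; lia.
  have [->|ne_ja] := eqVneq j a; first by lia.
  have : (a < j)%N by move: ne_ja; rewrite -val_eqE /=; lia.
  by move=> lt_aj; have := inc_ab a j (leqnn _) lt_aj le_jb; lia.
by rewrite leqnn andbT -ca leqnSn => /(_ isT); rewrite -val_eqE /=; lia.
Qed.

Lemma flattenedP n (s : 'S_n) :
  reflect (forall a c : 'I_n, run_start s a -> run_start s c ->
             (a < c)%N -> (s a < s c)%N)
          (flattened s).
Proof.
apply: (iffP forallP) => [flat a c /run_startP[b rab] /run_startP[d rcd] lt_ac|flat a].
  move: (flat a) => /forallP/(_ b)/forallP/(_ c)/forallP/(_ d)/implyP.
  by apply; apply/and3P.
apply/forallP=> b; apply/forallP=> c; apply/forallP=> d; apply/implyP=> /and3P[rab rcd].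
by apply: flat; apply/run_startP; [exists b | exists d].
Qed.

(** * The patterns 312 and 321 *)

Lemma avoids312P n (s : 'S_n) :
  reflect (forall i j k : 'I_n, (i < j)%N -> (j < k)%N ->
             (s j < s k)%N -> (s k < s i)%N -> False)
          (avoids s p312).
Proof.
have v0 : p312 (inord 0) = 2 :> nat by rewrite permE /fun312 !inordK.
have v1 : p312 (inord 1) = 0%N :> nat by rewrite permE /fun312 !inordK.
have v2 : p312 (inord 2) = 1%N :> nat by rewrite permE /fun312 !inordK.
have ordE (x : 'I_3) : [\/ x = inord 0, x = inord 1 | x = inord 2].
  by case: x => -[|[|[|x]]] hx //;
    [constructor 1|constructor 2|constructor 3]; apply: val_inj; rewrite /= inordK.
apply: (iffP negP) => [av i j k lt_ij lt_jk lt_sjk lt_ski | av].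
  apply: av; apply/existsP; exists [ffun x : 'I_3 => nth i [:: i; j; k] x].
  apply/andP; split; apply/forallP=> x; apply/forallP=> y; rewrite !ffunE;
    case: (ordE x) => ->; case: (ordE y) => ->; rewrite ?v0 ?v1 ?v2 !inordK //=; lia.
case/existsP=> f /andP[/forallP mon /forallP ord].
have mon' (x y : 'I_3) : (x < y)%N -> (f x < f y)%N.
  by have /forallP/(_ y)/implyP := mon x.
have ord' (x y : 'I_3) : (s (f x) < s (f y))%N = (p312 x < p312 y)%N.
  by have /forallP/(_ y)/eqP := ord x.
apply: (av (f (inord 0)) (f (inord 1)) (f (inord 2))).
- by apply: mon'; rewrite !inordK.
- by apply: mon'; rewrite !inordK.
- by rewrite ord' v1 v2.
- by rewrite ord' v2 v0.
Qed.

(** Between i and j there must be a descent; its last occurrence is where the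
    run of j begins, so that the entries from p to j increase. *)
Lemma run_start_between n (s : 'S_n) (i j : 'I_n) :
  (i < j)%N -> (s j < s i)%N ->
  exists p : 'I_n, [/\ (i < p)%N, (p <= j)%N, (s p <= s j)%N & run_start s p].
Proof.
case: j => j; elim: j => // j IHj hj lt_ij lt_sji.
have hj' : (j < n)%N by lia.
set j1 := Ordinal hj in lt_ij lt_sji *; set j0 := Ordinal hj'.
have [desc|asc] := ltnP (s j1) (s j0).
  exists j1; split=> // b [bj]; suff -> : b = j0 by [].
  exact: val_inj.
have neq : (s j0 : nat) <> s j1 by apply: perm_val_neq => /=.
have lt_ij0 : (i < j0)%N.
  have ne_ij : (i : nat) <> j.
    by move=> eij; move: lt_sji; rewrite (_ : i = j0); [lia | exact: val_inj].
  by move: lt_ij => /=; lia.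
have lt_s0i : (s j0 < s i)%N by lia.
have [p [lt_ip le_pj le_s start_p]] := IHj hj' lt_ij0 lt_s0i.
by exists p; split=> //; [exact: leqW | exact: leq_trans le_s asc].
Qed.

(** The permutation matrix of s is lower Hessenberg: nothing lies above its
    first superdiagonal. *)
Definition hessenberg n (s : 'S_n) : bool :=
  [forall i : 'I_n, s i <= i.+1]%N.

Lemma sum_ltn_ord n m : (\sum_(i < n) (i < m) = minn m n)%N.
Proof. by elim: n => [|n IHn]; rewrite ?big_ord0 ?big_ord_recr /= ?IHn; lia. Qed.

Lemma card_ord_ltn n m : #|[set i : 'I_n | (i < m)%N]| = minn m n.
Proof.
rewrite -sum_ltn_ord -sum1_card big_mkcond.
by apply: eq_bigr => i _; rewrite inE; case: ifP.
Qed.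

(** Avoiding both 312 and 321. If s i <= i + 1 for all i, then the first i + 1
    entries fill the values 0, ..., i + 1 up to a single gap, which cannot
    accommodate two entries. Conversely, when s i >= i + 2, at most i of the
    values below s i fit before position i, so at least two come after it. *)
Lemma hessenbergP n (s : 'S_n) :
  reflect (forall i j k : 'I_n, (i < j)%N -> (j < k)%N ->
             (s j < s i)%N -> (s k < s i)%N -> False)
          (hessenberg s).
Proof.
apply: (iffP forallP) => [below i j k lt_ij lt_jk lt_sji lt_ski | av i].
  pose A := [set x : 'I_n | (x < i.+1)%N] :|: [set j; k].
  have disj : [disjoint [set x : 'I_n | (x < i.+1)%N] & [set j; k]].
    rewrite disjoints_subset; apply/subsetP=> x; rewrite !inE.
    by rewrite negb_or -!val_eqE /=; lia.
  have cardA : #|A| = i.+3.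
    rewrite cardsU (disjoint_setI0 disj) cards0 subn0 card_ord_ltn cards2 -val_eqE /=.
    by have := ltn_ord i; lia.
  have sub : s @: A \subset [set y : 'I_n | (y < i.+2)%N].
    apply/subsetP=> y /imsetP[x xA ->]; have := below x; have := below i.
    by move: xA; rewrite !inE => /orP[|/orP[]/eqP-> ]; lia.
  have := subset_leq_card sub.
  by rewrite card_imset ?cardA ?card_ord_ltn; [lia | exact: perm_inj].
have [//|gt_si] := leqP (s i) i.+1.
pose A := [set x : 'I_n | (s x < s i)%N].
have cardA : #|A| = s i.
  rewrite /A -(card_imset _ (@perm_inj _ s)).
  have -> : s @: [set x : 'I_n | (s x < s i)%N] = [set y : 'I_n | (y < s i)%N].
    apply/setP=> y; rewrite inE; apply/imsetP/idP=> [[x] | lt_y].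
      by rewrite inE => ? ->.
    by exists (s^-1 y)%g; rewrite ?inE permKV.
  by rewrite card_ord_ltn; have := ltn_ord (s i); lia.
have : (1 < #|A :\: [set x : 'I_n | (x < i)%N]|)%N.
  have := cardsID [set x : 'I_n | (x < i)%N] A.
  have := subset_leq_card (subsetIr A [set x : 'I_n | (x < i)%N]).
  by rewrite card_ord_ltn cardA; lia.
case/card_gt1P=> j [k [jA kA ne_jk]].
have ne_ijk x : x \in A :\: [set x : 'I_n | (x < i)%N] -> (i < x)%N /\ (s x < s i)%N.
  rewrite !inE -leqNgt => /andP[le_ix lt_sx]; split=> //.
  rewrite ltn_neqAle le_ix andbT; apply: contraTneq lt_sx => e.
  by rewrite (val_inj e) ltnn.
have [lt_ij lt_sj] := ne_ijk j jA; have [lt_ik lt_sk] := ne_ijk k kA.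
have [lt_jk|lt_kj|/val_inj e] := ltngtP j k.
- by case: (av i j k).
- by case: (av i k j).
- by rewrite e eqxx in ne_jk.
Qed.

(** The condition at position 0 says that the run containing the entry 0, which
    starts with it, is the first one. *)
Lemma flattened_avoiding312E n (s : 'S_n.+1) :
  (s \in flattened_avoiding n.+1 p312) = (s ord0 == ord0) && hessenberg s.
Proof.
rewrite inE; apply/andP/andP=> [[/flattenedP flat /avoids312P av]|].
  split.
    have [//|ne0] := eqVneq (s ord0) ord0.
    set p := (s^-1)%g ord0.
    have sp : s p = ord0 by rewrite permKV.
    have p_gt0 : (0 < p)%N.
      rewrite lt0n; apply: contra ne0 => p0; have ep : p = ord0 by exact/eqP.
      by rewrite ep in sp; rewrite sp.
    have := flat ord0 p _ _ p_gt0; rewrite sp /= => abs; exfalso.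
    suff: (s ord0 < 0)%N by [].
    apply: abs => b //= bp; rewrite sp lt0n.
    by have := @perm_val_neq _ s b p _; rewrite sp /=; lia.
  apply/hessenbergP=> i j k lt_ij lt_jk lt_sji lt_ski.
  have ne : (s j : nat) <> s k by exact: perm_val_neq.
  have [lt_sjk|le_skj] := ltnP (s j) (s k); first exact: (av i j k).
  (* i, j, k form a pattern 321; the start p before k yields i, p, k as 312. *)
  have [p [lt_ip le_pj le_spj start_p]] := run_start_between lt_ij lt_sji.
  have lt_skj : (s k < s j)%N by lia.
  have [q [lt_jq le_qk le_sqk start_q]] := run_start_between lt_jk lt_skj.
  have lt_spq := flat p q start_p start_q (leq_ltn_trans le_pj lt_jq).
  apply: (av i p k); lia.
case=> /eqP s0 /hessenbergP below; split.
  apply/flattenedP=> a c start_a _ lt_ac.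
  have ne : (s a : nat) <> s c by exact: perm_val_neq.
  have [//|le_sca] := ltnP (s a) (s c).
  (* Otherwise the entry before position a exceeds both s a and s c. *)
  case: (posnP a) => [a0|a_gt0].
    have ea : a = ord0 by exact: val_inj.
    by move: ne le_sca; rewrite ea s0 /=; lia.
  have hb : (a.-1 < n.+1)%N by have := ltn_ord a; lia.
  have eb : (Ordinal hb).+1 = a by rewrite /= prednK.
  have := start_a _ eb => desc.
  case: (below (Ordinal hb) a c) => //; lia.
apply/avoids312P=> i j k lt_ij lt_jk lt_sjk lt_ski.
apply: (below i j k) => //; lia.
Qed.

(** * Peeling off the first entry *)

Lemma num_inv_sum n (s : 'S_n) :
  num_inv s = (\sum_(i < n) \sum_(j < n) ((i < j) && (s j < s i)))%N.
Proof.
rewrite /num_inv -sum1_card pair_big /= big_mkcond /=.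
by apply: eq_bigr => ij _; rewrite inE; case: ifP.
Qed.

(** The first entry j is inverted exactly with the j smaller values, all of
    which come later; the other inversions are those of t. *)
Lemma num_inv_lift_perm n (j : 'I_n.+1) (t : 'S_n) :
  num_inv (lift_perm ord0 j t) = (j + num_inv t)%N.
Proof.
rewrite !num_inv_sum big_ord_recl; congr (_ + _)%N.
  rewrite big_ord_recl /= add0n lift_perm_id.
  under eq_bigr => i _ do rewrite lift_perm_lift.
  transitivity (\sum_(i < n) (lift j i < j))%N; first by rewrite [RHS](reindex_perm t).
  rewrite (eq_bigr (fun i : 'I_n => (i < j)%N : nat)) ?sum_ltn_ord => [|i _].
    by have := ltn_ord j; lia.
  rewrite /= /bump; by case: (leqP j i); lia.
apply: eq_bigr => i _; rewrite big_ord_recl /= add0n.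
apply: eq_bigr => k _; rewrite !lift_perm_lift /= /bump; lia.
Qed.

(** Lifting t along position 0 and value j <= 1 moves its entries one position
    to the right and raises its values by one, except that the value 0 stays
    when j = 1; the bound is trivial for that value, so the condition on t is
    the same for both j. *)
Lemma hessenberg_lift_perm n (j : 'I_n.+1) (t : 'S_n) :
  hessenberg (lift_perm ord0 j t) = (j <= 1)%N && hessenberg t.
Proof.
apply/forallP/andP=> [below | [le_j1 /forallP below] i].
  have le_j1 : (j <= 1)%N by have := below ord0; rewrite lift_perm_id.
  split=> //; apply/forallP=> i; have := below (lift ord0 i).
  by rewrite lift_perm_lift /= /bump; lia.
case: (unliftP ord0 i) => [k|] ->; rewrite ?lift_perm_id ?lift_perm_lift //=.
by have := below k; rewrite /bump; lia.
Qed.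

Lemma sum_lift_perm (R : nmodType) n (F : 'S_n.+1 -> R) :
  \sum_s F s = \sum_j \sum_t F (lift_perm ord0 j t).
Proof.
rewrite pair_big /= (reindex (fun p : 'I_n.+1 * 'S_n => lift_perm ord0 p.1 p.2)) //=.
apply/onW_bij/inj_card_bij; last by rewrite card_prod !card_Sn card_ord factS.
move=> [j t] [k u] /= e.
have ejk : j = k by rewrite -(lift_perm_id ord0 j t) e lift_perm_id.
rewrite ejk in e *; congr pair; apply/permP=> i; apply: (@lift_inj _ k).
by rewrite -2!(lift_perm_lift ord0) e.
Qed.

(** The factor 1 + q records the two possible first entries, 0 and 1. *)
Lemma sum_inv_hessenberg (R : comNzRingType) (q : R) n :
  \sum_(s : 'S_n.+1 | hessenberg s) q ^+ num_inv s = (1 + q) ^+ n.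
Proof.
elim: n => [|n IHn].
  have all1 (s : 'S_1) : s = 1%g by apply/permP=> i; rewrite [LHS]ord1 [RHS]ord1.
  rewrite (big_pred1 1%g) => [|s]; first by rewrite num_inv_sum !big_ord1 ltnn.
  rewrite [RHS](introT eqP (all1 s)); apply/forallP=> i; have := ltn_ord (s i); lia.
rewrite big_mkcond sum_lift_perm 2!big_ord_recl [X in _ + (_ + X)]big1 ?addr0.
  rewrite exprS mulrDl mul1r -IHn mulr_sumr.
  congr (_ + _).
    rewrite [RHS]big_mkcond; apply: eq_bigr => t _.
    by rewrite hessenberg_lift_perm num_inv_lift_perm.
  rewrite [RHS]big_mkcond; apply: eq_bigr => t _.
  by rewrite hessenberg_lift_perm num_inv_lift_perm /= exprD expr1.
by move=> j _; apply: big1 => t _; rewrite hessenberg_lift_perm.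
Qed.

Unset Implicit Arguments.

Theorem theorem2p12 (n : nat) (hn : (2 <= n)%N) :
  \sum_(s in flattened_avoiding n p312) 'X^(num_inv s) = (1 + 'X) ^+ (n - 2)
    :> {poly int}.
Proof.
case: n hn => [|[|n]] // _; rewrite subn2 /= -sum_inv_hessenberg.
rewrite big_mkcond sum_lift_perm big_ord_recl [X in _ + X]big1 ?addr0; last first.
  move=> j _; apply: big1 => t _.
  by rewrite flattened_avoiding312E lift_perm_id.
rewrite [RHS]big_mkcond; apply: eq_bigr => t _.
by rewrite flattened_avoiding312E lift_perm_id eqxx hessenberg_lift_perm
           num_inv_lift_perm.
Qed.
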